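(* Let $G$ be an $n$-vertex $d$-degenerate graph with maximum degree $\Delta$. Then, for every positive integer $L$, the number of walks in $G$ of length $L$ is at most $2n\,2^{L}(d\Delta)^{L/2}$.
   Context: All graphs are finite, simple, undirected and connected. A graph is $d$-degenerate if each of its subgraphs has a vertex of degree at most $d$. A walk of length $L$ is a sequence of $L+1$ vertices in which consecutive vertices are adjacent. *)

(* Defs.v *)
From mathcomp Require Import all_boot all_order all_algebra.
From mathcomp Require Import reals exp.

Set Implicit Arguments.
Unset Strict Implicit.
Unset Printing Implicit Defensive.

Record sgraph := SGraph {
  vertex :> finType;
  adj : rel vertex;
  adj_sym : symmetric adj;
  adj_irr : irreflexive adj }.

Definition graph_connected (G : sgraph) : Prop :=
  0 < #|G| /\ forall x y : G, connect (@adj G) x y.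

Definition degree (G : sgraph) (x : G) : nat := #|[set y | adj x y]|.

Definition max_degree (G : sgraph) : nat := \max_(x : G) degree x.

(* Subgraphs are arbitrary, not necessarily induced or connected. *)
Record subgraph (G : sgraph) := Subgraph {
  sub_vertex : {set G};
  sub_adj : rel G;
  sub_adj_sym : symmetric sub_adj;
  sub_adjP : forall x y : G, sub_adj x y ->
    [/\ x \in sub_vertex, y \in sub_vertex & adj x y] }.

Definition sub_degree (G : sgraph) (H : subgraph G) (x : G) : nat :=
  #|[set y | sub_adj H x y]|.

(* The subgraph without vertices has to be excluded explicitly. *)
Definition degenerate (G : sgraph) (d : nat) : Prop :=
  forall H : subgraph G, sub_vertex H != set0 ->
    exists2 x, x \in sub_vertex H & sub_degree H x <= d.

(* [sorted r s] says that r relates all consecutive items of s; no order on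
   the vertices is involved. Walks are vertex sequences, so a walk and its
   reversal are counted separately. *)
Definition walks (G : sgraph) (L : nat) : {set L.+1.-tuple G} :=
  [set w : L.+1.-tuple G | sorted (@adj G) w].

(* Main.v *)
Require Import Defs.
From mathcomp Require Import all_boot all_order all_algebra.
From mathcomp Require Import reals exp.
Import Order.TTheory GRing.Theory Num.Theory.

(** The number of walks of length [L] is the sum of the entries of [A ^ L 1],
    where [A] is the adjacency matrix and [1] the all-ones vector. By
    Cauchy-Schwarz its square is at most [n] times the squared Euclidean norm
    of [A ^ L 1], so it is enough to bound the operator norm of [A] by
    [2 * sqrt (d * Delta)].

    Repeatedly deleting a vertex of degree at most [d], and directing its
    remaining edges away from it, orients [G] with all out-degrees at most [d]
    ([degenerate_orientation]); all in-degrees are at most [Delta]. Hence [A] is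
    at most [U + U^T] entrywise, where [U] is the matrix of the orientation, with
    row sums at most [d] and column sums at most [Delta]. The Schur test
    ([rel_sum_schur]) bounds the squared norm of both [U] and [U^T] by
    [d * Delta], and so that of [A] by [4 * d * Delta] ([adj_sum_norm]).

    All of this is done with squares of natural numbers, so that square roots
    only appear when the bound
    [#walks ^ 2 <= n ^ 2 * (4 * d * Delta) ^ L] is turned into the real one. It
    is sharper than the theorem by the factor [2]. *)

Lemma sum_cauchy_schwarz (I : finType) (P : pred I) (f : I -> nat) :
  (\sum_(i | P i) f i) ^ 2 <= #|P| * \sum_(i | P i) f i ^ 2.
Proof.
rewrite -(leq_pmul2l (isT : 0 < 2)) -mulnn big_distrlr /= big_distrr /=.
have -> : 2 * (#|P| * \sum_(i | P i) f i ^ 2)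
        = \sum_(i | P i) \sum_(j | P j) (f i ^ 2 + f j ^ 2).
  under [RHS]eq_bigr do rewrite big_split /= sum_nat_const.
  by rewrite big_split /= -big_distrr /= sum_nat_const mul2n addnn.
apply: leq_sum => i _; rewrite big_distrr /=.
by apply: leq_sum => j _; exact: nat_Cauchy.
Qed.

(** Schur test for a 0-1 matrix: Cauchy-Schwarz on each row costs a factor [a],
    and after exchanging the sums each [f y ^ 2] is counted at most [b] times. *)
Lemma rel_sum_schur {T : finType} {e : rel T} {a b : nat} (f : T -> nat) :
  (forall x, #|[pred y | e x y]| <= a) ->
  (forall y, #|[pred x | e x y]| <= b) ->
  \sum_x (\sum_(y | e x y) f y) ^ 2 <= a * b * \sum_x f x ^ 2.
Proof.
move=> ea eb; rewrite -mulnA big_distrr /=.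
apply: (@leq_trans (a * \sum_x \sum_(y | e x y) f y ^ 2)).
  rewrite big_distrr; apply: leq_sum => x _.
  apply: leq_trans (sum_cauchy_schwarz _ _ _) _.
  by rewrite leq_mul2r ea orbT.
rewrite leq_mul2l; apply/orP; right.
rewrite (exchange_big_dep xpredT) //=; apply: leq_sum => y _.
by rewrite sum_nat_const leq_mul2r eb orbT.
Qed.

Section Walks.

Variable G : sgraph.

Definition induced_adj (S : {set G}) : rel G :=
  fun x y => [&& x \in S, y \in S & adj x y].

Lemma induced_adj_sym S : symmetric (induced_adj S).
Proof. by move=> x y; rewrite /induced_adj adj_sym andbCA. Qed.

Lemma induced_adjP S x y :
  induced_adj S x y -> [/\ x \in S, y \in S & adj x y].
Proof. by case/and3P. Qed.

Definition induced_subgraph (S : {set G}) : subgraph G :=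
  Subgraph (induced_adj_sym S) (@induced_adjP S).

Lemma degenerate_orientation {d : nat} : degenerate G d ->
  exists e : rel G,
    [/\ subrel e (@adj G), forall x y, adj x y -> e x y || e y x
      & forall x, #|[pred y | e x y]| <= d].
Proof.
move=> degG.
(* Only edges inside [S] have to be directed, but out-degrees are bounded
   everywhere: directing the edges of a new vertex of [S] away from it leaves
   all other out-degrees unchanged. *)
suff /(_ [set: G]) [e [e_adj e_tot e_deg]] : forall S : {set G},
    exists e : rel G,
    [/\ subrel e (@adj G), {in S &, forall x y, adj x y -> e x y || e y x}
      & forall x, #|[pred y | e x y]| <= d].
  by exists e; split=> // x y; apply: e_tot; rewrite inE.
move=> S; have [m] := ubnP #|S|; elim: m S => // m IHm S leSm.
have [->|S_neq0] := eqVneq S set0.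
  exists (fun _ _ => false); split=> [//|x y|x]; first by rewrite inE.
  by rewrite (eq_card0 (fun _ => _)).
have [/= x0 x0S x0_deg] := degG (induced_subgraph S) S_neq0.
have [|e [e_adj e_tot e_deg]] := IHm (S :\ x0).
  by move: leSm; rewrite (cardsD1 x0 S) x0S.
exists (fun x y => if x == x0 then induced_adj S x y else e x y); split.
- by move=> x y; case: eqP => _; [case/and3P | exact: e_adj].
- move=> x y xS yS xy; rewrite /induced_adj xS yS xy adj_sym xy /=.
  case: eqVneq => //= x_neq; case: eqVneq => /= [|y_neq]; first by rewrite orbT.
  by apply: e_tot; rewrite ?inE ?x_neq ?y_neq.
move=> x; case: (eqVneq x x0) => [->|_] /=; last exact: e_deg.
by move: x0_deg; rewrite /sub_degree cardsE.
Qed.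

(** The squared operator norm of the adjacency matrix is at most
    [4 * d * Delta]: a factor [2] comes from the two directions of the edges,
    and another [2] from [(u + v) ^ 2 <= 2 * (u ^ 2 + v ^ 2)]. *)
Lemma adj_sum_norm {d : nat} (f : G -> nat) : degenerate G d ->
  \sum_x (\sum_(y | adj x y) f y) ^ 2
    <= 4 * (d * max_degree G) * \sum_x f x ^ 2.
Proof.
case/degenerate_orientation=> e [e_adj e_tot e_deg].
have e_indeg y : #|[pred x | e x y]| <= max_degree G.
  apply: leq_trans (leq_bigmax y); rewrite /degree cardsE.
  by apply/subset_leq_card/subsetP=> x; rewrite !inE => /e_adj; rewrite adj_sym.
have out_le := rel_sum_schur f e_deg e_indeg.
have in_le := @rel_sum_schur _ (fun x y => e y x) _ _ f e_indeg e_deg.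
rewrite (mulnC (max_degree G)) in in_le.
apply: (@leq_trans (2 * (\sum_x (\sum_(y | e x y) f y) ^ 2
                         + \sum_x (\sum_(y | e y x) f y) ^ 2))); last first.
  rewrite -[4]/(2 * 2) -!(mulnA 2) leq_pmul2l // mul2n -addnn.
  exact: leq_add.
rewrite -big_split big_distrr /=; apply: leq_sum => x _.
set u := \sum_(y | e x y) f y; set v := \sum_(y | e y x) f y.
apply: (@leq_trans ((u + v) ^ 2)).
  rewrite leq_exp2r // /u /v big_mkcond [\sum_(y | e x y) _]big_mkcond.
  rewrite [\sum_(y | e y x) _]big_mkcond -big_split /=.
  apply: leq_sum => y _; case: ifP => // /e_tot.
  by case: (e x y) => /= [_|->]; rewrite ?leq_addr.
by rewrite sqrnD [leqRHS]mul2n -addnn leq_add2l nat_Cauchy.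
Qed.

(** The vector [A ^ k 1]: its entry at [x] counts the walks of length [k] that
    start at [x]. *)
Fixpoint walks_from (k : nat) (x : G) : nat :=
  if k is k'.+1 then \sum_(y | adj x y) walks_from k' y else 1.

Lemma big_tuple_cons (T : finType) (k : nat) (F : seq T -> nat) :
  \sum_(w : k.+1.-tuple T) F w = \sum_x \sum_(w : k.-tuple T) F (x :: w).
Proof.
rewrite pair_big /= (reindex (fun p : T * k.-tuple T => [tuple of p.1 :: p.2])).
  by apply: eq_bigr.
exists (fun w : k.+1.-tuple T => (thead w, [tuple of behead w])) => w _ /=.
  by case: w => x w /=; congr pair; apply: val_inj.
by rewrite [RHS]tuple_eta.
Qed.

Lemma card_path k x :
  \sum_(w : k.-tuple G) path (@adj G) x w = walks_from k x.
Proof.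
elim: k x => [|k IHk] x /=.
  by rewrite (big_pred1 [tuple]) //= => w; apply/esym/eqP; exact: tuple0.
rewrite (big_tuple_cons _ _ (fun w => path (@adj G) x w)) [RHS]big_mkcond /=.
apply: eq_bigr => y _; rewrite -IHk; case: (adj x y) => //=.
by rewrite big1.
Qed.

Lemma card_walks L : #|walks G L| = \sum_x walks_from L x.
Proof.
rewrite cardsE -sum1_card big_mkcond /=.
rewrite (big_tuple_cons _ _ (fun w => if sorted (@adj G) w then 1 else 0)) /=.
by apply: eq_bigr => x _; rewrite -card_path.
Qed.

Lemma walks_from_norm {d : nat} k : degenerate G d ->
  \sum_x walks_from k x ^ 2 <= #|G| * (4 * (d * max_degree G)) ^ k.
Proof.
move=> degG; elim: k => [|k IHk] /=; first by rewrite sum_nat_const.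
apply: leq_trans (adj_sum_norm _ degG) _.
by rewrite expnS [leqRHS]mulnCA leq_mul2l IHk orbT.
Qed.

Lemma card_walks_sqr {d : nat} L : degenerate G d ->
  #|walks G L| ^ 2 <= #|G| ^ 2 * (4 * (d * max_degree G)) ^ L.
Proof.
move=> degG; rewrite card_walks.
apply: leq_trans (sum_cauchy_schwarz _ _ _) _.
by rewrite -mulnn -mulnA leq_mul2l (walks_from_norm _ degG) orbT.
Qed.

End Walks.

Local Open Scope ring_scope.

Theorem lemma4 (R : realType) (G : sgraph) (n d Delta : nat)
  (G_conn : graph_connected G) (G_n : #|G| = n) (G_degen : degenerate G d)
  (G_Delta : max_degree G = Delta) (L : nat) (L_gt0 : (0 < L)%N) :
  #|walks G L|%:R <=
    2 * n%:R * 2 ^+ L * ((d%:R * Delta%:R) `^ (L%:R / 2)) :> R.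
Proof.
set s := _ `^ _.
have s_ge0 : 0 <= s by exact: powR_ge0.
have s_sqr : s ^+ 2 = (d%:R * Delta%:R) ^+ L.
  by rewrite -powR_mulrn // -powRrM divfK ?pnatr_eq0 // powR_mulrn // mulr_ge0.
have bound_ge0 : 0 <= n%:R * 2 ^+ L * s by rewrite !mulr_ge0 ?exprn_ge0.
apply: (@le_trans _ _ (n%:R * 2 ^+ L * s)); last first.
  by rewrite -!mulrA ler_peMl ?ler1n // mulrA.
rewrite -ler_sqr ?nnegrE // !exprMn s_sqr exprAC -mulrA -exprMn.
have := card_walks_sqr G L G_degen.
by rewrite -(ler_nat R) !(natrX, natrM) G_n G_Delta -(natrX R 2 2).
Qed.
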